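(* Let $\Gamma=(V,E,d_\Gamma)$ be a metric tree with no vertices of degree $2$, with vertex set $V$, edge set $E\subseteq\binom V2$ and metric $d_\Gamma$. Then there is an isometric embedding $\Gamma\hookrightarrow(\mathcal H^1,d_{\mathcal H})$ if and only if both of the following hold: 1. $\deg_\Gamma(v)\le |\mathfrak K|+1$ for all $v\in V$, where $|\mathfrak K|$ is the cardinality of the residue field $\mathfrak K$ of $K$; 2. $d_\Gamma(v,v')\in\mathrm{val}(K^\ast)$ for every edge $(v,v')\in E$ that is not a leaf edge.
   Context: $K$ is a field with a non-trivial valuation $\mathrm{val}\colon K\to\mathbb R\cup\{\infty\}$, complete with respect to the associated non-Archimedean absolute value $|a|=\exp(-\mathrm{val}(a))$ (base fixed). $\mathfrak K$ is its residue field. $\hat K$ is the completion of an algebraic closure of $K$, with the unique extension of $\mathrm{val}$. For $a\in K$, $v\in\mathbb R$, $B_{\mathcal H}(a,v)=\{z\in\hat K:\mathrm{val}(a-z)\ge v\}$. The space $\mathcal H^1$ is the set of all such discs. For $B=B_{\mathcal H}(a,v)$, $B'=B_{\mathcal H}(a',v')$ the join is $B\vee B'=B\cup B'$ if one contains the other, and $B\vee B'=B_{\mathcal H}(a,\mathrm{val}(a-a'))$ otherwise. The metric $d_{\mathcal H}$ on $\mathcal H^1$ is $d_{\mathcal H}(B,B')=|v-v'|$ if one of $B,B'$ contains the other, and $d_{\mathcal H}(B,B')=d_{\mathcal H}(B,B\vee B')+d_{\mathcal H}(B\vee B',B')$ otherwise. A metric tree is a combinatorial tree with positive edge lengths, regarded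 as a metric space by identifying each edge with an interval of its length and using the path metric. A leaf edge is an edge incident to a vertex of degree $1$. *)

(* Defs.v *)
From HB Require Import structures.
From mathcomp Require Import all_boot all_order all_algebra.
From mathcomp Require Import all_classical all_reals all_analysis.
Set Implicit Arguments.
Unset Strict Implicit.
Unset Printing Implicit Defensive.
Import Order.TTheory GRing.Theory Num.Theory.
Local Open Scope classical_set_scope.
Local Open Scope ring_scope.

Section Valuation.
Context {R : realType} {K : fieldType}.
Implicit Type val : K -> \bar R.

Record is_valuation val : Prop := {
  val_eqy : forall x, val x = +oo%E <-> x = 0;
  val_neNy : forall x, val x <> -oo%E;
  valM : forall x y, val (x * y) = (val x + val y)%E;
  valD : forall x y, (Order.min (val x) (val y) <= val (x + y)%R)%E }.

Definition nontrivial_valuation val := exists2 x, x != 0 & val x <> 0%E.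

(* The values of the nonzero elements of K. *)
Definition value_group val : set R :=
  [set v | exists2 x, x != 0 & val x = v%:E].

(* |a| = exp (- val a), with exp (-oo) = 0. *)
Definition vabs val (a : K) : \bar R := expeR (- val a)%E.

Definition vcauchy val (u : nat -> K) :=
  forall e : R, 0 < e -> exists N, forall m n,
    (N <= m)%N -> (N <= n)%N -> (vabs val (u m - u n)%R < e%:E)%E.

Definition vconverges val (u : nat -> K) (l : K) :=
  forall e : R, 0 < e -> exists N, forall n,
    (N <= n)%N -> (vabs val (u n - l)%R < e%:E)%E.

Definition vcomplete val := forall u, vcauchy val u -> exists l, vconverges val u l.

(* The residue class a + m of a, where m = {x | val x > 0}. *)
Definition residue_class val (a : K) : set K :=
  [set b | (0 < val (b - a)%R)%E].

(* The residue field O / m, O = {x | val x >= 0}, as the set of cosets of m in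
   O; only its cardinality is needed, so no ring structure is put on it. *)
Definition residue_field val : set (set K) :=
  [set residue_class val a | a in [set a | (0 <= val a)%E]].

End Valuation.

(* Kbar is an algebraic closure of K (through i), and Khat is a completion of
   Kbar (through j) for a valuation extending val. The extension of val to Kbar
   is valhat \o j. *)
Record completed_alg_closure (R : realType) (K : fieldType) (val : K -> \bar R)
    (Kbar : closedFieldType) (i : {rmorphism K -> Kbar})
    (Khat : fieldType) (j : {rmorphism Kbar -> Khat})
    (valhat : Khat -> \bar R) : Prop := {
  cac_algebraic : forall x : Kbar, algebraicOver i x;
  cac_valuation : is_valuation valhat;
  cac_extends : forall a : K, valhat (j (i a)) = val a;
  cac_dense : forall (z : Khat) (e : R), 0 < e ->
    exists x : Kbar, (vabs valhat (z - j x)%R < e%:E)%E;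
  cac_complete : vcomplete valhat }.

Section Discs.
Context {R : realType} {K Khat : fieldType}.
(* iota is the inclusion of K in Khat. *)
Variables (val : K -> \bar R) (iota : K -> Khat) (valhat : Khat -> \bar R).

Definition disc (a : K) (v : R) : set Khat :=
  [set z | (v%:E <= valhat (iota a - z)%R)%E].

Definition discs : set (set Khat) := [set B | exists a v, B = disc a v].

(* A chosen presentation (a, v) of B = disc a v. The radius v is determined by
   B, because the value group of Khat is dense in R; the centre a is not. *)
Definition presentation (B : set Khat) : K * R :=
  xget (0, 0) [set p : K * R | B = disc p.1 p.2].
Definition centre B := (presentation B).1.
Definition radius B := (presentation B).2.

(* In the last case the discs are disjoint, so the centres differ, val of their
   difference is finite, and it does not depend on the chosen centres. *)
Definition join (B B' : set Khat) : set Khat :=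
  if `[< B `<=` B' \/ B' `<=` B >] then B `|` B'
  else disc (centre B) (fine (val (centre B - centre B'))).

Definition dH_nested (B B' : set Khat) : R := `|radius B - radius B'|.

Definition dH (B B' : set Khat) : R :=
  if `[< B `<=` B' \/ B' `<=` B >] then dH_nested B B'
  else dH_nested B (join B B') + dH_nested (join B B') B'.

End Discs.

(* A graph on V is given by its adjacency relation E, and len u w is the length
   of the edge {u, w} (irrelevant when u and w are not adjacent). *)
Section MetricTree.
Context {R : realType} {V : choiceType}.
Variables (E : rel V) (len : V -> V -> R).

Record is_metric_tree : Prop := {
  mt_sym : symmetric E;
  mt_irr : irreflexive E;
  mt_connected : forall u w, exists2 p, path E u p & last u p = w;
  mt_acyclic : forall c, ucycle E c -> (size c <= 2)%N;
  mt_len_sym : forall u w, E u w -> len u w = len w u;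
  mt_len_gt0 : forall u w, E u w -> 0 < len u w }.

Definition neighbours (v : V) : set V := [set w | E v w].

(* V may be infinite, and degrees are cardinals. *)
Definition has_degree (v : V) (n : nat) : Prop := (neighbours v #= `I_n)%card.

Definition leaf_edge (u w : V) : Prop :=
  E u w /\ (has_degree u 1 \/ has_degree w 1).

(* Points of the geometric realization are given by barycentric coordinates
   V -> R, so that edges are glued along common endpoints. *)
Definition vertex_point (v : V) : V -> R := \1_[set v].

Definition segment (u w : V) : set (V -> R) :=
  [set p | exists2 s : R, 0 <= s <= 1 &
    p = (fun x => (1 - s) * vertex_point u x + s * vertex_point w x)].

Definition realization : set (V -> R) :=
  range vertex_point `|`
  [set p | exists u w, E u w /\ segment u w p].

(* chain p q l: a piecewise linear path of length l from p to q, each step of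
   which stays inside one edge. Coordinate w identifies the edge {u, w} with
   [0, 1], so the identification with [0, len u w] scales it by len u w. *)
Inductive chain : (V -> R) -> (V -> R) -> R -> Prop :=
| chain_nil p : chain p p 0
| chain_step u w p q r l : E u w -> segment u w p -> segment u w q ->
    chain q r l -> chain p r (len u w * `|p w - q w| + l).

Definition tree_dist (p q : V -> R) : R := inf [set l | chain p q l].

End MetricTree.

Definition isometric_embedding (R : realType) (X Y : Type)
    (A : set X) (dA : X -> X -> R) (B : set Y) (dB : Y -> Y -> R)
    (f : X -> Y) : Prop :=
  set_fun A B f /\
  forall x y, A x -> A y -> dB (f x) (f y) = dA x y.

(* Main.v *)
Require Import Defs.
From mathcomp Require Import all_boot all_order all_algebra.
From mathcomp Require Import all_classical all_reals all_analysis.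
From mathcomp Require Import lra ring.
Set Implicit Arguments.
Unset Strict Implicit.
Unset Printing Implicit Defensive.
Import Order.TTheory GRing.Theory Num.Theory.
Local Open Scope classical_set_scope.
Local Open Scope ring_scope.

(* Represent a disc by a centre a and a radius r. For X = (a, r) and
   Y = (b, s) put m(X, Y) = min(r, s, val(a - b)). Then the distance is
   r + s - 2 m(X, Y), and m is ultrametric, which gives the four-point
   condition. Hence a map from a tree that is isometric on edges and does not
   fold at vertices (it is additive on pairs of edges at a common vertex) is
   isometric.

   Given the two conditions, such a map is built outwards from a root. At each
   vertex the neighbours are sent injectively to "up" or to a residue class,
   with the direction of the parent prescribed; the prescription is met by
   composing with a transposition. Going up keeps the centre and decreases the
   radius; going down into the class of t adds c t to the centre, where val c
   is the current radius, and increases the radius. Such a c exists at every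
   vertex of degree at least 2 by the condition on lengths.

   Conversely, at a vertex y of an embedded tree at most one neighbour lies
   outside the disc of y, and the centres of any two others differ by an
   element of valuation the radius of y. So they give distinct residue classes,
   and the radius is in the value group as soon as deg y >= 3. *)

(** * Valuations *)

Section ValuationTheory.
Context {R : realType} {K : fieldType} {val : K -> \bar R}.
Hypothesis hval : is_valuation val.

Lemma val0 : val 0 = +oo%E.
Proof. by apply/(val_eqy hval). Qed.

Lemma val_fin x : x != 0 -> exists v : R, val x = v%:E.
Proof.
move=> x0; case E : (val x) => [v| |]; first by exists v.
- by move/(val_eqy hval): E => E; rewrite E eqxx in x0.
- by case: (val_neNy hval E).
Qed.

Lemma val1 : val 1 = 0%E.
Proof.
have [v E] := val_fin (oner_neq0 K).
have := Defs.valM hval 1 1; rewrite mulr1 E -EFinD => -[vv].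
by congr (_%:E); lra.
Qed.

Lemma valX x (v : R) n : val x = v%:E -> val (x ^+ n) = (n%:R * v)%:E.
Proof.
move=> E; elim: n => [|n IH]; first by rewrite expr0 mul0r val1.
by rewrite exprS (Defs.valM hval) IH E -EFinD -natr1 mulrDl mul1r addrC.
Qed.

Lemma valN x : val (- x) = val x.
Proof.
have N1 : (-1 : K) != 0 by rewrite oppr_eq0 oner_neq0.
have [v E] := val_fin N1.
have := valX 2 E; rewrite sqrrN expr1n val1 => -[v0].
rewrite -mulN1r (Defs.valM hval) E (_ : v = 0) ?add0e//; lra.
Qed.

Lemma valBC x y : val (x - y) = val (y - x).
Proof. by rewrite -valN opprB. Qed.

Lemma valV x (v : R) : val x = v%:E -> val x^-1 = (- v)%:E.
Proof.
move=> E; have x0 : x != 0 by apply/eqP => x0; move: E; rewrite x0 val0.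
have [w F] := val_fin (invr_neq0 x0).
have := Defs.valM hval x x^-1; rewrite divff// val1 E F -EFinD => -[vw].
by congr (_%:E); lra.
Qed.

Lemma val_fin_neq0 x (v : R) : val x = v%:E -> x != 0.
Proof. by move=> E; apply/eqP => x0; move: E; rewrite x0 val0. Qed.

Lemma le_valD t x y : (t <= val x -> t <= val y -> t <= val (x + y)%R)%E.
Proof.
by move=> tx ty; apply: le_trans (valD hval x y); rewrite le_min tx ty.
Qed.

Lemma le_valB t x y z :
  (t <= val (x - y)%R -> t <= val (y - z)%R -> t <= val (x - z)%R)%E.
Proof. by move=> xy yz; rewrite -(subrKA y); exact: le_valD. Qed.

Lemma val_isosceles x y : (val x < val y)%E -> val (x + y) = val x.
Proof.
move=> xy; apply/le_anti/andP; split; last by apply: le_valD => //; exact: ltW.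
rewrite leNgt; apply/negP => h.
have : (Order.min (val (x + y)%R) (val y) <= val x)%E.
  by rewrite -[X in (_ <= val X)%E](addrK y) -(valN y) (valD hval).
by rewrite ge_min !leNgt h xy.
Qed.

Lemma value_group0 : value_group val 0.
Proof. by exists 1; [exact: oner_neq0|exact: val1]. Qed.

Lemma value_groupD v w :
  value_group val v -> value_group val w -> value_group val (v + w).
Proof.
move=> [x x0 xv] [y y0 yw]; exists (x * y); first by rewrite mulf_neq0.
by rewrite (Defs.valM hval) xv yw.
Qed.

Lemma value_groupN v : value_group val v -> value_group val (- v).
Proof.
by move=> [x x0 xv]; exists x^-1; [rewrite invr_neq0|exact: valV].
Qed.

Lemma value_groupB v w :
  value_group val v -> value_group val w -> value_group val (v - w).
Proof. by move=> gv gw; apply: value_groupD => //; exact: value_groupN. Qed.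

End ValuationTheory.

(** * The metric on discs *)

Section DiscMetric.
Context {R : realType} {K : fieldType} {val : K -> \bar R}.
Hypothesis hval : is_valuation val.
Implicit Types X Y Z W : K * R.

(* The radius of the smallest disc containing the discs [X] and [Y]. A radius
   is a lower bound for valuations, so larger discs have smaller radii. *)
Definition join_radius X Y : R :=
  fine (Order.min (Order.min X.2%:E Y.2%:E) (val (X.1 - Y.1))).

Definition disc_dist X Y : R := X.2 + Y.2 - 2 * join_radius X Y.

Lemma join_radiusE X Y : (join_radius X Y)%:E =
  Order.min (Order.min X.2%:E Y.2%:E) (val (X.1 - Y.1)).
Proof.
rewrite fineK// -EFin_min; case: (eqVneq (X.1 - Y.1) 0) => [->|n0].
  by rewrite (val0 hval) miney.
by have [v ->] := val_fin hval n0; rewrite -EFin_min.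
Qed.

Lemma le_join_radius (t : R) X Y : (t <= join_radius X Y) =
  [&& t <= X.2, t <= Y.2 & (t%:E <= val (X.1 - Y.1)%R)%E].
Proof. by rewrite -lee_fin join_radiusE !le_min !lee_fin andbA. Qed.

Lemma join_radius_le X Y : join_radius X Y <= X.2 /\ join_radius X Y <= Y.2.
Proof.
by have := le_join_radius (join_radius X Y) X Y; rewrite lexx => /esym/and3P[].
Qed.

Lemma join_radius_val X Y : ((join_radius X Y)%:E <= val (X.1 - Y.1)%R)%E.
Proof.
by have := le_join_radius (join_radius X Y) X Y; rewrite lexx => /esym/and3P[].
Qed.

Lemma join_radius_eq (t : R) X Y : t <= X.2 -> t <= Y.2 ->
  (t%:E <= val (X.1 - Y.1)%R)%E ->
  t = X.2 \/ t = Y.2 \/ t%:E = val (X.1 - Y.1) -> join_radius X Y = t.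
Proof.
move=> tX tY tv h; apply/le_anti/andP; split; last first.
  by rewrite le_join_radius tX tY.
have [jX jY] := join_radius_le X Y; have jv := join_radius_val X Y.
by case: h => [->|[->|E]]//; rewrite -lee_fin E.
Qed.

Lemma join_radiusC X Y : join_radius X Y = join_radius Y X.
Proof. by rewrite /join_radius (valBC hval) [Order.min X.2%:E _]minC. Qed.

Lemma join_radius_ultra X Y Z :
  Order.min (join_radius X Y) (join_radius Y Z) <= join_radius X Z.
Proof.
set t := Order.min _ _.
have tXY : t <= join_radius X Y by rewrite ge_min lexx.
have tYZ : t <= join_radius Y Z by rewrite ge_min lexx orbT.
move: tXY tYZ; rewrite !le_join_radius => /and3P[a b c] /and3P[d e f].
by rewrite a e (le_valB hval c f).
Qed.

Lemma disc_distC X Y : disc_dist X Y = disc_dist Y X.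
Proof. by rewrite /disc_dist join_radiusC [X.2 + _]addrC. Qed.

Lemma disc_dist_triangle Y X Z :
  disc_dist X Z <= disc_dist X Y + disc_dist Y Z.
Proof.
have := join_radius_ultra X Y Z; have := join_radius_le X Y.
have := join_radius_le Y Z; rewrite /disc_dist ge_min.
by move=> [a b] [c d] /orP[]; lra.
Qed.

(** In terms of [m], the sum of m(X, Z) and m(Y, W) is at least the smaller of the two other sums.
    This follows from the ultrametric inequality for X, Z through Y and through W, and for Y, W
    through X and through Z; each resulting case is linear. *)
Lemma disc_dist_four_point X Y Z W :
  disc_dist X Z + disc_dist Y W <=
  Order.max (disc_dist X Y + disc_dist Z W) (disc_dist X W + disc_dist Y Z).
Proof.
have := join_radius_ultra X Y Z; have := join_radius_ultra X W Z.
have := join_radius_ultra Y X W; have := join_radius_ultra Y Z W.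
rewrite /disc_dist !ge_min le_max (join_radiusC W Z) (join_radiusC Y X).
by move=> /orP[]? /orP[]? /orP[]? /orP[]?; apply/orP;
  case: (lerP (join_radius X Y + join_radius Z W)
     (join_radius X Z + join_radius Y W)) => ?; (try by left; lra); right; lra.
Qed.

(* Nonbacktracking paths of discs are geodesics: geodesic paths sharing a
   nontrivial segment can be glued. *)
Lemma disc_dist_glue X Y Z W : 0 < disc_dist Y Z ->
  disc_dist X Z = disc_dist X Y + disc_dist Y Z ->
  disc_dist Y W = disc_dist Y Z + disc_dist Z W ->
  disc_dist X W = disc_dist X Y + disc_dist Y Z + disc_dist Z W.
Proof.
move=> yz xz yw; have := disc_dist_four_point X Y Z W; rewrite le_max.
have := disc_dist_triangle Y X W.
by move=> ? /orP[]?; lra.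
Qed.

Lemma disc_dist_nested X Y : X.2 <= Y.2 -> (X.2%:E <= val (X.1 - Y.1)%R)%E ->
  disc_dist X Y = Y.2 - X.2.
Proof.
move=> le v; rewrite /disc_dist (@join_radius_eq X.2)//; first by lra.
by left.
Qed.

Lemma disc_dist_self X : disc_dist X X = 0.
Proof. by rewrite disc_dist_nested ?subrr// (val0 hval) leey. Qed.

End DiscMetric.

(** * Discs as sets, and the distance between them *)

Section Discs.
Context {R : realType} {K Khat : fieldType} {val : K -> \bar R}
  {iota : {rmorphism K -> Khat}} {valhat : Khat -> \bar R}.
Hypotheses (hval : is_valuation val) (hvalhat : is_valuation valhat)
  (val_iota : forall a, valhat (iota a) = val a)
  (val_dense : forall s t : R, s < t ->
     exists z, (s%:E <= valhat z)%E /\ (valhat z < t%:E)%E).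
Local Notation disc := (Defs.disc iota valhat).
Local Notation dH := (Defs.dH val iota valhat).

Lemma sub_disc a b (r s : R) :
  disc a r `<=` disc b s <-> s <= r /\ (s%:E <= val (a - b)%R)%E.
Proof.
split=> [sub|[sr ab] z]; last first.
  rewrite /Defs.disc/= => az; rewrite (valBC hvalhat).
  apply: (le_valB hvalhat (y := iota a)); last by rewrite -rmorphB val_iota.
  by rewrite (valBC hvalhat); apply: le_trans az; rewrite lee_fin.
have ab : (s%:E <= val (a - b)%R)%E.
  rewrite (valBC hval) -val_iota rmorphB; apply: (sub (iota a)).
  by rewrite /Defs.disc/= subrr (val0 hvalhat) leey.
(* If [r < s], density gives [z] with [r <= valhat z < s], and then [iota a - z] lies in the first
   disc but not in the second. *)
split=> //; rewrite leNgt; apply/negP => /val_dense[z [rz zs]].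
have : disc b s (iota a - z).
  by apply: sub; rewrite /Defs.disc/= opprB addrC subrK.
rewrite /Defs.disc/= => /(le_valB hvalhat (x := iota a)).
rewrite -rmorphB val_iota => /(_ ab); rewrite opprB addrC subrK.
by rewrite leNgt zs.
Qed.

Lemma eq_disc a b (r s : R) :
  disc a r = disc b s <-> r = s /\ (r%:E <= val (a - b)%R)%E.
Proof.
split=> [/seteqP[/sub_disc[sr ab] /sub_disc[rs _]]|[<- ab]].
  have -> : r = s by apply/le_anti/andP.
  by [].
by apply/seteqP; split; apply/sub_disc; split=> //; rewrite (valBC hval).
Qed.

Lemma presentationP a (r : R) :
  Defs.radius iota valhat (disc a r) = r /\
  (r%:E <= val (Defs.centre iota valhat (disc a r) - a)%R)%E.
Proof.
rewrite /Defs.radius /Defs.centre /Defs.presentation.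
case: xgetP => [p _ /= h|/(_ (a, r))/=].
  by move/esym/eq_disc: h => [e ]; rewrite e.
by case.
Qed.

Lemma dH_disc (X Y : K * R) :
  dH (disc X.1 X.2) (disc Y.1 Y.2) = disc_dist (val := val) X Y.
Proof.
have [rX cX] := presentationP X.1 X.2; have [rY cY] := presentationP Y.1 Y.2.
rewrite /Defs.dH /Defs.join /dH_nested rX rY.
case: asboolP => [[/sub_disc[le h]|/sub_disc[le h]]|nested].
- rewrite (disc_distC hval) disc_dist_nested//; last by rewrite (valBC hval).
  by rewrite ger0_norm ?subr_ge0.
- rewrite disc_dist_nested//; last by rewrite (valBC hval).
  by rewrite distrC ger0_norm ?subr_ge0.
set x := centre _ _ _ in cX *; set y := centre _ _ _ in cY *.
(* Since neither disc contains the other, the valuation of the difference of centres is below both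
   radii. *)
have lt : (val (X.1 - Y.1) < (Order.min X.2 Y.2)%:E)%E.
  rewrite ltNge; apply/negP; rewrite EFin_min ge_min => /orP h; apply: nested.
  case: (leP X.2 Y.2) => XY; [right|left]; apply/sub_disc.
  - split=> //; rewrite (valBC hval); case: h => //; apply: le_trans.
    by rewrite lee_fin.
  - split; first exact: ltW.
    by case: h => //; apply: le_trans; rewrite lee_fin ltW.
have n0 : X.1 - Y.1 != 0.
  by apply/eqP => E; move: lt; rewrite E (val0 hval) ltNge leey.
have [v v_def] := val_fin hval n0.
move: lt; rewrite v_def lte_fin lt_min => /andP[vX vY].
have -> : val (x - y) = v%:E.
  rewrite -v_def.
  (* Changing the centres within their discs adds only a term of larger valuation. *)
  have -> : x - y = X.1 - Y.1 + ((x - X.1) - (y - Y.1)) by ring.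
  apply: (val_isosceles hval); rewrite v_def.
  apply: (@lt_le_trans _ _ (Order.min X.2 Y.2)%:E).
    by rewrite lte_fin lt_min vX.
  apply: (le_valD hval).
    by apply: le_trans cX; rewrite lee_fin ge_min lexx.
  by rewrite (valN hval); apply: le_trans cY; rewrite lee_fin ge_min lexx orbT.
have [-> _] := presentationP x v.
rewrite /= /disc_dist (@join_radius_eq _ _ _ hval v)//; try exact: ltW.
- by rewrite ger0_norm ?subr_ge0 ?ltW// ler0_norm ?subr_le0 ?ltW//; lra.
- by rewrite v_def.
- by right; right.
Qed.

End Discs.

(** * Density of the values of [valhat] *)

Section DenseValues.
Context {R : realType} {K : fieldType} {val : K -> \bar R}
  {Kbar : closedFieldType} {i : {rmorphism K -> Kbar}}
  {Khat : fieldType} {j : {rmorphism Kbar -> Khat}} {valhat : Khat -> \bar R}.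
Hypotheses (hval : is_valuation val) (hnontriv : nontrivial_valuation val)
  (hKhat : completed_alg_closure val i j valhat).

Lemma exists_val_gt0 : exists2 x, x != 0 & exists2 v : R, 0 < v & val x = v%:E.
Proof.
have [x x0 vx] := hnontriv; have [v E] := val_fin hval x0.
have v0 : v != 0 by apply/eqP => v0; apply: vx; rewrite E v0.
case: (ltrgt0P v) => [vp|vn|/eqP]; last by rewrite (negbTE v0).
- by exists x => //; exists v.
- exists x^-1; first by rewrite invr_neq0.
  by exists (- v); [rewrite oppr_gt0|exact: (valV hval)].
Qed.

(** An element of positive value has roots of every order in [Kbar]. A root of large order has a
    value [d] with [0 < d < t - s], and some integer multiple of [d] falls between [s] and [t]. *)
Lemma valhat_dense (s t : R) : s < t ->
  exists z, (s%:E <= valhat z)%E /\ (valhat z < t%:E)%E.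
Proof.
move=> st; have hvalhat := cac_valuation hKhat.
have [x x0 [v v0 xv]] := exists_val_gt0.
pose n := (Num.truncn (v / (t - s))).
have dts : v / n.+1%:R < t - s.
  rewrite ltr_pdivrMr ?ltr0n// mulrC -ltr_pdivrMr ?subr_gt0//.
  exact: truncnS_gt.
have [y yE] : exists y : Kbar, y ^+ n.+1 = i x.
  have := @solve_monicpoly Kbar n.+1 (fun k => if k == 0%N then i x else 0) isT.
  case=> y yE; exists y; rewrite yE big_ord_recl/= mulr1 big1 ?addr0// => k _.
  by rewrite mul0r.
have jy0 : j y != 0.
  rewrite fmorph_eq0; apply/eqP => y0.
  move: yE; rewrite y0 expr0n/= => /esym/eqP.
  by rewrite fmorph_eq0 (negbTE x0).
have [d dE] := val_fin hvalhat jy0.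
have dv : n.+1%:R * d = v.
  have := valX hvalhat n.+1 dE.
  by rewrite -rmorphXn/= yE (cac_extends hKhat) xv => -[].
have {dv} dv : d = v / n.+1%:R by rewrite -dv mulrC mulKf// pnatr_eq0.
have d0 : 0 < d by rewrite dv divr_gt0.
have dts' : d < t - s by rewrite dv.
have valz (k : int) : valhat (j y ^ k) = (k%:~R * d)%:E.
  case: k => k; first exact: (valX hvalhat).
  rewrite NegzE -exprnN (valV hvalhat (valX hvalhat k.+1 dE)).
  by rewrite mulrNz mulNr.
exists (j y ^ Num.ceil (s / d)); rewrite valz lee_fin lte_fin.
rewrite -ler_pdivrMr// ceil_ge; split => //.
have : (Num.ceil (s / d))%:~R < s / d + 1.
  by have := ceilB1_lt (s / d); rewrite intrB; lra.
rewrite -(ltr_pM2r d0 _ (s / d + 1)) mulrDl mul1r divfK ?gt_eqF// => h.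
by apply: lt_trans h _; lra.
Qed.

End DenseValues.

(** * Simple paths in trees *)

Section SimplePaths.
Context {R : realType} {V : choiceType} {E : rel V} {len : V -> V -> R}.
Hypothesis htree : is_metric_tree E len.
Let Esym := mt_sym htree.

Lemma edge_neq u w : E u w -> u != w.
Proof. by move=> uw; apply/eqP => e; move: uw; rewrite e (mt_irr htree). Qed.

(** Otherwise the part of [p] up to [w], closed by the edge from [w] to [u], would be a cycle with
    at least three vertices. *)
Lemma nbr_on_simple_path u w p :
  E u w -> path E u p -> uniq (u :: p) -> w \in p -> exists q, p = w :: q.
Proof.
move=> uw up Uup wp; case/splitPr: wp up Uup => p1 p2.
rewrite -cat_rcons cat_path -cat_cons cat_uniq => /andP[p1E _] /andP[U _].
have c : ucycle E (u :: rcons p1 w).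
  by rewrite /ucycle /ucycleb U andbT /cycle rcons_path p1E last_rcons Esym.
have := mt_acyclic htree c; rewrite /= size_rcons !ltnS leqn0 => /nilP ->.
by exists p2.
Qed.

(** If the paths left [a] through different neighbours [b] and [c], going from [b] to the common end
    and back to [c] would avoid [a]. This would give a simple path from [a] through [b] that meets
    the neighbour [c] of [a] after its first step. *)
Lemma simple_path_unique p q a : path E a p -> path E a q ->
  uniq (a :: p) -> uniq (a :: q) -> last a p = last a q -> p = q.
Proof.
elim: p q a => [|b p IH] [|c q] a //=.
- by move=> _ _ _ /andP[/negP+ _] e; rewrite {1}e mem_last.
- by move=> _ _ /andP[/negP+ _] _ e; rewrite -{1}e mem_last.
move=> /andP[ab bp] /andP[ac cq] /andP[nab Ubp] /andP[nac Ucq] e.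
have [ebc|nbc] := eqVneq b c.
  by move: ebc ac cq nac Ucq e => <- _ cq _ Ucq e; rewrite (IH q b).
pose t := p ++ rev (belast c q).
have tE : path E b t.
  by rewrite cat_path bp e rev_path (eq_path (e' := E)).
have at_ : a \notin b :: t.
  rewrite -cat_cons mem_cat mem_rev (negbTE nab)/=.
  by apply: contra nac => /mem_belast.
have tc : last b t = c.
  rewrite last_cat; case: (q) e => [|d q'] /= e; first by rewrite e.
  by rewrite rev_cons last_rcons.
case: (shortenP tE) tc => t' t'E Ut' subt tc.
have Uat : uniq (a :: b :: t').
  rewrite cons_uniq Ut' andbT; apply: contra at_; rewrite !inE.
  by case/orP => [->//|/subt ->]; rewrite orbT.
have ct : c \in b :: t' by rewrite -tc mem_last.
have [|t2 [+ _]] := nbr_on_simple_path ac _ Uat ct; first by rewrite /= ab.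
by move/eqP; rewrite (negbTE nbc).
Qed.

Definition tree_path (r x : V) : seq V :=
  xget [::] [set p | [/\ path E r p, uniq (r :: p) & last r p = x]].

Lemma tree_pathP r x : [/\ path E r (tree_path r x), uniq (r :: tree_path r x)
  & last r (tree_path r x) = x].
Proof.
have [p rp <-] := mt_connected htree r x; case: (shortenP rp) => p' ? ? _.
rewrite /tree_path; case: xgetP => [q ->//|/(_ p')]; by case.
Qed.

Lemma tree_path_eq r p : path E r p -> uniq (r :: p) ->
  tree_path r (last r p) = p.
Proof.
move=> rp Up; have [? ? ?] := tree_pathP r (last r p).
exact: (simple_path_unique (a := r)).
Qed.

(** If [y] lies on the path to [x], the rest of that path after [y] must start with the neighbour
    [x] of [y], and so it ends there. Thus every edge is oriented away from [r]. *)
Lemma tree_path_edge r x y : E x y ->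
  tree_path r y = rcons (tree_path r x) y \/
  tree_path r x = rcons (tree_path r y) x.
Proof.
move=> xy; have [rx Ux lx] := tree_pathP r x.
have [yin|yout] := boolP (y \in r :: tree_path r x); last first.
  left; rewrite -[X in tree_path r X](last_rcons r (tree_path r x) y).
  apply: tree_path_eq; first by rewrite rcons_path rx lx.
  by rewrite -rcons_cons rcons_uniq yout.
right; case/splitPl: yin rx Ux lx => p1 p2 ly.
rewrite cat_path last_cat ly => /andP[rp1 yp2].
rewrite -cat_cons cat_uniq => /and3P[Up1 disj Up2] lx.
have -> : tree_path r y = p1 by rewrite -ly tree_path_eq.
have [q qE] : exists q, p2 = x :: q.
  apply: (@nbr_on_simple_path y) => //; first by rewrite Esym.
    rewrite /= Up2 andbT; apply: contra disj => yp; apply/hasP.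
    by exists y => //; rewrite -ly mem_last.
  case: (p2) lx => [/= yx|z s <-]; last by rewrite /= mem_last.
  by move: xy; rewrite yx (mt_irr htree).
suff -> : p2 = [:: x] by rewrite cats1.
move: lx Up2; rewrite qE => lx /= /andP[xq _]; congr cons.
by case: q lx xq {qE} => // a q /= <-; rewrite mem_last.
Qed.
End SimplePaths.
Arguments tree_path {V} E r x.

(** * The metric of the realization *)

Section Chains.
Context {R : realType} {V : choiceType} {E : rel V} {len : V -> V -> R}.
Hypothesis htree : is_metric_tree E len.
Let Esym := mt_sym htree.
Implicit Types (u w x : V) (s : R) (p q : V -> R).
Local Notation chain := (chain E len).
Local Notation tree_dist := (tree_dist E len).

Lemma vertex_pointE u x : vertex_point u x = (x == u)%:R :> R.
Proof.
rewrite /vertex_point indicE; congr (_%:R); congr nat_of_bool.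
by apply/idP/eqP => [/set_mem//|->]; exact: mem_set.
Qed.

Definition segment_point u w s : V -> R :=
  fun x => (1 - s) * vertex_point u x + s * vertex_point w x.

Lemma segmentP u w p :
  segment u w p <-> exists2 s, 0 <= s <= 1 & p = segment_point u w s.
Proof. by []. Qed.

Lemma segment_point0 u w : segment_point u w 0 = vertex_point u.
Proof. by apply/funext => x; rewrite /segment_point; lra. Qed.

Lemma segment_point1 u w : segment_point u w 1 = vertex_point w.
Proof. by apply/funext => x; rewrite /segment_point; lra. Qed.

Lemma segment_pointC u w s : segment_point u w s = segment_point w u (1 - s).
Proof. by apply/funext => x; rewrite /segment_point; lra. Qed.

Lemma segment_point_end u w s : u != w -> segment_point u w s w = s.
Proof.
move=> uw; rewrite /segment_point !vertex_pointE eqxx [w == u]eq_sym.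
by rewrite (negbTE uw) mulr0 add0r mulr1.
Qed.

(** At points of the realization the sum has finite support, since at most two coordinates are
    nonzero. *)
Definition affine_ext (phi : V -> R) p : R := \sum_(x \in setT) p x * phi x.

Lemma affine_ext_segment phi u w s : u != w ->
  affine_ext phi (segment_point u w s) = (1 - s) * phi u + s * phi w.
Proof.
move=> uw; rewrite /affine_ext -(fsbig_widen [set` [:: u; w]])//.
  rewrite -fsbig_seq/=; last by rewrite inE uw.
  rewrite big_cons big_seq1 /segment_point !vertex_pointE !eqxx [w == u]eq_sym.
  by rewrite (negbTE uw) /=; ring.
move=> x [_ /= /negP]; rewrite !inE negb_or => /andP[xu xw].
rewrite /preimage/= /segment_point !vertex_pointE (negbTE xu) (negbTE xw) /=.
by ring.
Qed.

Lemma affine_ext_vertex phi u : affine_ext phi (vertex_point u) = phi u.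
Proof.
rewrite /affine_ext -(fsbig_widen [set u])//.
  by rewrite fsbig_set1 vertex_pointE eqxx mul1r.
move=> x [_ /= /eqP xu].
by rewrite /preimage/= vertex_pointE (negbTE xu) mul0r.
Qed.

(** A source of lower bounds for [tree_dist], with [D] either the variation of a function on the
    tree or a distance of discs. *)
Lemma chain_lower (D : (V -> R) -> (V -> R) -> R) :
  (forall p, D p p = 0) -> (forall q p r, D p r <= D p q + D q r) ->
  (forall u w s t, E u w -> 0 <= s <= 1 -> 0 <= t <= 1 ->
    D (segment_point u w s) (segment_point u w t) <= len u w * `|s - t|) ->
  forall p q l, chain p q l -> D p q <= l.
Proof.
move=> D0 Dtri Dseg p q l; elim => {p q l} [p|]; first by rewrite D0.
move=> u w p q r l uw /segmentP[s s01 ->] /segmentP[t t01 ->] _ IH.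
rewrite !segment_point_end ?(edge_neq htree)//.
apply: le_trans (Dtri (segment_point u w t) _ _) _.
by apply: lerD => //; exact: Dseg.
Qed.

Lemma chain_trans p q r l l' :
  chain p q l -> chain q r l' -> chain p r (l + l').
Proof.
move=> pq; elim: pq l' => {p q l} [p l' |u w p q r' l uw up uq _ IH l' qr].
  by rewrite add0r.
by rewrite -addrA; apply: chain_step uw up uq _; exact: IH.
Qed.

Lemma chain_segment u w s t : E u w -> 0 <= s <= 1 -> 0 <= t <= 1 ->
  chain (segment_point u w s) (segment_point u w t) (len u w * `|s - t|).
Proof.
move=> uw s01 t01; rewrite -[_ * _]addr0.
rewrite -{2}(segment_point_end s (edge_neq htree uw)).
rewrite -{2}(segment_point_end t (edge_neq htree uw)).
apply: (chain_step (q := segment_point u w t)) => //; last exact: chain_nil.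
- by exists s.
- by exists t.
Qed.

Fixpoint path_len x (p : seq V) : R :=
  if p is y :: p' then len x y + path_len y p' else 0.

Lemma path_len_rcons x (p : seq V) y :
  path_len x (rcons p y) = path_len x p + len (last x p) y.
Proof.
by elim: p x => [|z p IH] x /=; rewrite ?addr0 ?add0r// IH addrA.
Qed.

Lemma chain_path x (p : seq V) : path E x p ->
  chain (vertex_point x) (vertex_point (last x p)) (path_len x p).
Proof.
elim: p x => [x _|y p IH x /= /andP[xy yp]]; first exact: chain_nil.
apply: chain_trans (IH _ yp).
have := @chain_segment x y 0 1 xy; rewrite segment_point0 segment_point1.
by rewrite sub0r normrN normr1 mulr1; apply; rewrite lexx ler01.
Qed.

Lemma tree_dist_le D p q l : (forall l', chain p q l' -> D <= l') ->
  chain p q l -> D <= tree_dist p q <= l.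
Proof.
move=> lb c; apply/andP; split; first by apply: lb_le_inf; [exists l|].
by apply: ge_inf => //; exists D.
Qed.

Lemma tree_dist_eq p q l : (forall l', chain p q l' -> l <= l') ->
  chain p q l -> tree_dist p q = l.
Proof.
by move=> lb c; apply/le_anti; rewrite andbC; exact: tree_dist_le.
Qed.

(* The lower bound comes from the depth function of the tree rooted at [x],
   which is 1-Lipschitz. *)
Lemma tree_dist_path x (p : seq V) : path E x p -> uniq (x :: p) ->
  tree_dist (vertex_point x) (vertex_point (last x p)) = path_len x p.
Proof.
move=> xp Up; apply: tree_dist_eq; last exact: chain_path.
pose depth y := path_len x (tree_path E x y).
pose D p q := `|affine_ext depth p - affine_ext depth q|.
have edge u w : E u w -> `|depth u - depth w| <= len u w.
  move=> uw; have l0 := mt_len_gt0 htree uw.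
  have [_ _ lu] := tree_pathP htree x u; have [_ _ lw] := tree_pathP htree x w.
  have [e|e] := tree_path_edge htree x uw; rewrite /depth e path_len_rcons.
    by rewrite lu opprD addNKr normrN gtr0_norm.
  by rewrite lw addrC addKr -(mt_len_sym htree uw) gtr0_norm.
move=> l /(@chain_lower D); rewrite /D !affine_ext_vertex /depth.
have [/esym e0 e1] : tree_path E x x = [::] /\ tree_path E x (last x p) = p.
  split; last exact: (tree_path_eq htree xp Up).
  exact: (tree_path_eq htree (p := [::])).
rewrite e1 -e0 /= sub0r normrN => h; apply: le_trans (ler_norm _) _; apply: h.
- by move=> q; rewrite subrr normr0.
- by move=> *; exact: ler_distD.
move=> u w s t uw _ _; rewrite !affine_ext_segment ?(edge_neq htree)//.
have -> (a b : R) :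
    (1 - s) * a + s * b - ((1 - t) * a + t * b) = (a - b) * (t - s) by ring.
by rewrite normrM [`|t - s|]distrC ler_wpM2r// edge.
Qed.

Lemma tree_dist_edge u w : E u w ->
  tree_dist (vertex_point u) (vertex_point w) = len u w.
Proof.
move=> uw; have := @tree_dist_path u [:: w]; rewrite /= uw addr0; apply => //.
by rewrite inE (edge_neq htree).
Qed.

Lemma tree_dist_turn y x z : E y x -> E y z -> x != z ->
  tree_dist (vertex_point x) (vertex_point z) = len y x + len y z.
Proof.
move=> yx yz xz; have := @tree_dist_path x [:: y; z].
rewrite /= Esym yx yz addr0 -(mt_len_sym htree yx); apply => //.
by rewrite !inE negb_or xz eq_sym !(edge_neq htree).
Qed.

End Chains.
Arguments path_len {R V} len x p.

(** * Locally geodesic maps are isometric *)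

Section LocalToGlobal.
Context {R : realType} {V : choiceType} {E : rel V} {len : V -> V -> R}.
Hypothesis htree : is_metric_tree E len.
Let Esym := mt_sym htree.
Local Notation chain := (chain E len).
Local Notation tree_dist := (tree_dist E len).

(** By connectedness a vertex lies on an edge as soon as there is a second vertex. The alternative
    [p = q] is there for the tree with a single vertex. *)
Lemma realization_segments (p q : V -> R) :
  realization E p -> realization E q ->
  p = q \/ (exists u w, E u w /\ segment u w p) /\
           (exists u w, E u w /\ segment u w q).
Proof.
have vertex_segment x y : E x y -> segment x y (vertex_point x : V -> R).
  by move=> _; exists 0; [rewrite lexx ler01|exact/esym/(segment_point0 x y)].
have nbr (x y : V) : x != y -> exists z, E x z.
  move=> xy; have [[|z s] /= pth l] := mt_connected htree x y.
    by rewrite l eqxx in xy.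
  by case/andP: pth => xz _; exists z.
have other (x u w : V) : E u w -> exists y, x != y.
  move=> uw; have [->|xu] := eqVneq x u; last by exists u.
  by exists w; exact: (edge_neq htree uw).
move=> [[x _ <-]|hp] [[y _ <-]|hq].
- have [->|xy] := eqVneq x y; [by left|right].
  have [z xz] := nbr _ _ xy; rewrite eq_sym in xy; have [t yt] := nbr _ _ xy.
  by split; [exists x, z|exists y, t]; split => //; exact: vertex_segment.
- right; split=> //; have [u [w [uw _]]] := hq.
  have [y /nbr[z xz]] := other x _ _ uw; exists x, z; split=> //.
  exact: vertex_segment.
- right; split=> //; have [u [w [uw _]]] := hp.
  have [x /nbr[z xz]] := other y _ _ uw; exists y, z; split=> //.
  exact: vertex_segment.
- by right.
Qed.

(** With the second edge pointing away from [u], the path from [u] to [w'] ends with it. This path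
    begins with the edge to [w] if it meets [w]; otherwise it can be prolonged backwards by [w]. *)
Lemma simple_path_two_edges u w u' w' : E u w -> E u' w' ->
  [\/ u' = u /\ w' = w, u' = w /\ w' = u |
   exists u1 w1 u2 w2 p,
   [/\ (u1, w1) = (u, w) \/ (u1, w1) = (w, u),
       (u2, w2) = (u', w') \/ (u2, w2) = (w', u'),
       path E u1 (w1 :: rcons p w2), uniq (u1 :: w1 :: rcons p w2) &
       last w1 p = u2]].
Proof.
wlog e : u' w' / tree_path E u w' = rcons (tree_path E u u') w'.
  move=> wl uw uw'; have [e|e] := tree_path_edge htree u uw'; first exact: wl.
  have wu' : E w' u' by rewrite Esym.
  case: (wl w' u' e uw wu') => [[-> ->]|[-> ->]|].
  - exact: Or32.
  - exact: Or31.
  move=> [u1 [w1 [u2 [w2 [p [h1 h2 h3 h4 h5]]]]]]; apply: Or33.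
  exists u1, w1, u2, w2, p; split=> //.
  by case: h2; [right|left].
move=> uw uw'; have [pth U _] := tree_pathP htree u w'.
have [_ _ lu] := tree_pathP htree u u'.
rewrite e in pth U.
have [win|wout] := boolP (w \in rcons (tree_path E u u') w').
  have [q qE] := nbr_on_simple_path htree uw pth U win.
  case: (tree_path E u u') lu qE pth U => [/= <- [<- _] _ _|y s /= lu [yw _]].
    exact: Or31.
  rewrite {}yw in lu * => pth U.
  by apply: Or33; exists u, w, u', w', s; split=> //; left.
apply: Or33; exists w, u, u', w', (tree_path E u u').
have U' : uniq (w :: u :: rcons (tree_path E u u') w').
  by rewrite cons_uniq U andbT inE negb_or wout eq_sym (edge_neq htree uw).
by split=> //; [right|left|rewrite /= Esym uw].
Qed.

Context {K : fieldType} {val : K -> \bar R} {F : (V -> R) -> K * R}.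
Hypothesis hval : is_valuation val.
Local Notation D p q := (disc_dist (val := val) (F p) (F q)).
Hypothesis F_segment : forall u w s t, E u w -> 0 <= s <= 1 -> 0 <= t <= 1 ->
  D (segment_point u w s) (segment_point u w t) = len u w * `|s - t|.
Hypothesis F_turn : forall y x z, E y x -> E y z -> x != z ->
  D (vertex_point x) (vertex_point z) = len y x + len y z.

Lemma disc_dist_edge u w : E u w ->
  D (vertex_point u) (vertex_point w) = len u w.
Proof.
move=> uw; have := F_segment (s := 0) (t := 1) uw.
rewrite segment_point0 segment_point1 sub0r normrN normr1 mulr1; apply;
by rewrite lexx ler01.
Qed.

(** By induction: the path up to its last vertex but one and the turn at that vertex overlap in an
    edge, along which they are glued. *)
Lemma disc_dist_path x p : path E x p -> uniq (x :: p) ->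
  D (vertex_point x) (vertex_point (last x p)) = path_len len x p.
Proof.
have step q z : path E x (rcons q z) -> uniq (x :: rcons q z) ->
    D (vertex_point x) (vertex_point z) =
    D (vertex_point x) (vertex_point (last x q)) + len (last x q) z.
  elim/last_ind: q z => [|q y IH] z.
    rewrite /= andbT (disc_dist_self hval) add0r => xz _.
    exact: disc_dist_edge.
  move=> pth U; have [pth' yz] : path E x (rcons q y) /\ E y z.
    by move: pth; rewrite rcons_path last_rcons => /andP[].
  have [_ y'y] : path E x q /\ E (last x q) y.
    by move: pth'; rewrite rcons_path => /andP[].
  have [U' zn] : uniq (x :: rcons q y) /\ z \notin x :: rcons q y.
    by move: U; rewrite -rcons_cons rcons_uniq => /andP[].
  have y'z : last x q != z.
    apply: contraNneq zn => <-; rewrite -rcons_cons mem_rcons inE mem_last.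
    by rewrite orbT.
  have yy' : E y (last x q) by rewrite Esym.
  rewrite last_rcons -(disc_dist_edge yz) (IH y)// -(disc_dist_edge y'y).
  apply: (disc_dist_glue hval).
  - by rewrite disc_dist_edge// (mt_len_gt0 htree).
  - by rewrite (IH y)// (disc_dist_edge y'y).
  - by rewrite (F_turn yy' yz y'z) !disc_dist_edge// (mt_len_sym htree yy').
elim/last_ind: p => [|p z IH] pth U; first by rewrite (disc_dist_self hval).
rewrite last_rcons (step p z)// path_len_rcons IH//.
- by move: pth; rewrite rcons_path => /andP[].
- by move: U; rewrite -rcons_cons rcons_uniq => /andP[].
Qed.

(** The disc distance never exceeds the length of a chain, so a single chain that is not longer than
    it settles both inequalities. *)
Lemma tree_dist_of_chain p q l :
  chain p q l -> l <= D p q -> D p q = tree_dist p q.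
Proof.
move=> c le; have /andP[h1 h2] : D p q <= tree_dist p q <= l.
  apply: tree_dist_le => // l'.
  apply: (chain_lower htree (D := fun p q => D p q)) => {p q l c le l'}.
  - by move=> p; exact: (disc_dist_self hval).
  - by move=> q p r; exact: disc_dist_triangle.
  - by move=> u w s t *; rewrite F_segment.
by apply/le_anti; rewrite h1 (le_trans h2 le).
Qed.

Lemma local_to_global p q : realization E p -> realization E q ->
  D p q = tree_dist p q.
Proof.
move=> Ep Eq; case: (realization_segments Ep Eq) => [->|].
  apply: tree_dist_of_chain; first exact: chain_nil.
  by rewrite (disc_dist_self hval).
move=> [[u [w [uw up]]] [u' [w' [uw' uq]]]].
have same (a b : V) s t : E a b -> 0 <= s <= 1 -> 0 <= t <= 1 ->
    D (segment_point a b s) (segment_point a b t) =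
    tree_dist (segment_point a b s) (segment_point a b t).
  move=> ab s01 t01; apply: tree_dist_of_chain.
    exact: (chain_segment htree ab s01 t01).
  by rewrite F_segment.
have C01 (s : R) : 0 <= s <= 1 -> 0 <= 1 - s <= 1 by lra.
have segmentC (a b : V) (r : V -> R) : segment a b r -> segment b a r.
  by move=> [s s01 ->]; exists (1 - s); [exact: C01|exact: segment_pointC].
case: (simple_path_two_edges uw uw') => [[e1 e2]|[e1 e2]|].
- move: uq; rewrite {}e1 {}e2 => -[t t01 ->]; case: up => s s01 ->; exact: same.
- move: uq; rewrite {}e1 {}e2 => /segmentC[t t01 ->]; case: up => s s01 ->.
  exact: same.
move=> [u1 [w1 [u2 [w2 [pt [h1 h2 pth U l2]]]]]].
have {up h1} [s s01 pE] : segment u1 w1 p.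
  by case: h1 => -[-> ->] //; exact: segmentC.
have {uq h2} [t t01 qE] : segment u2 w2 q.
  by case: h2 => -[-> ->] //; exact: segmentC.
have := pth; rewrite /= rcons_path l2 => /and3P[e1 pth' e2].
have L := disc_dist_path pth U; rewrite /= last_rcons path_len_rcons l2 in L.
have h00 : 0 <= (0 : R) <= 1 by rewrite lexx ler01.
have h11 : 0 <= (1 : R) <= 1 by rewrite lexx ler01.
have c1 := chain_segment htree e1 s01 h11.
have c2 := chain_segment htree e2 h00 t01.
rewrite segment_point1 in c1.
rewrite segment_point0 in c2.
have c3 := chain_path htree pth'; rewrite l2 in c3.
have d1 := F_segment e1 h00 s01; have d2 := F_segment e2 t01 h11.
rewrite segment_point0 in d1; rewrite segment_point1 in d2.
rewrite pE qE; apply: tree_dist_of_chain (chain_trans c1 (chain_trans c3 c2)) _.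
(* The distance of the outer ends [u1] and [w2], minus the pieces cut off by [p] and [q], is a lower
   bound. It equals the length of the chain through [w1] and [u2]. *)
have := disc_dist_triangle hval (F (segment_point u1 w1 s))
  (F (vertex_point u1)) (F (vertex_point w2)).
have := disc_dist_triangle hval (F (segment_point u2 w2 t))
  (F (segment_point u1 w1 s)) (F (vertex_point w2)).
rewrite L d1 d2 !sub0r !normrN.
case/andP: s01 => s0 s1; case/andP: t01 => t0 t1.
rewrite !(ger0_norm s0) !(ger0_norm t0) !ler0_norm ?subr_le0//.
rewrite !opprB; lra.
Qed.

End LocalToGlobal.

(** * Construction of an embedding *)

Section Directions.
Context {R : realType} {K : fieldType} {val : K -> \bar R}.
Hypothesis hval : is_valuation val.

Lemma eq_residue_class (a b : K) :
  residue_class val a = residue_class val b <-> (0 < val (a - b)%R)%E.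
Proof.
split=> [e|ab].
  have : residue_class val a a by rewrite /residue_class/= subrr (val0 hval).
  by rewrite e.
have sub (x y : K) : (0 < val (x - y)%R)%E ->
    residue_class val x `<=` residue_class val y.
  move=> xy z; rewrite /residue_class/= => zx.
  have : (Order.min (val (z - x)%R) (val (x - y)%R) <= val (z - y)%R)%E.
    by rewrite -(subrKA x z (- y)); exact: (valD hval).
  by apply: lt_le_trans; rewrite lt_min zx.
by apply/seteqP; split; apply: sub => //; rewrite (valBC hval).
Qed.

(** Integral elements of different classes differ by a unit. The class of zero is represented by [0]
    so that the direction [Some 0] keeps the centre. *)
Lemma residue_representatives : exists rep : set K -> K,
  rep (residue_class val 0) = 0 /\
  forall C, residue_field val C -> (0 <= val (rep C))%E /\
    forall C', residue_field val C' -> C <> C' -> val (rep C - rep C')%R = 0%E.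
Proof.
pose rep C : K := if `[< C = residue_class val 0 >] then 0 else
  xget 0 [set a | (0 <= val a)%E /\ residue_class val a = C].
have repP C : residue_field val C ->
    (0 <= val (rep C))%E /\ residue_class val (rep C) = C.
  move=> [a a0 aC]; rewrite /rep; case: asboolP => [->|_].
    by rewrite (val0 hval) leey.
  by case: xgetP => [b _ //|/(_ a)]; case.
exists rep; split; first by rewrite /rep asboolT.
move=> C hC; have [C0 CE] := repP C hC; split=> // C' hC' CC'.
have [C'0 C'E] := repP C' hC'; apply/le_anti/andP; split; last first.
  by apply: (le_valD hval) => //; rewrite (valN hval).
by rewrite leNgt; apply/negP => /eq_residue_class; rewrite CE C'E.
Qed.

(* [None] is the direction towards larger discs, and [Some r] is the direction
   of the discs inside the residue disc of [r]. *)
Definition different_directions (d e : option K) : Prop :=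
  match d, e with
  | None, None => False
  | Some r, Some s => val (r - s) = 0%E
  | _, _ => True
  end.

Context {V : choiceType} {E : rel V}.

Definition direction_assignment (v : V) (g : V -> option K) : Prop :=
  (forall x r, E v x -> g x = Some r -> (0 <= val r)%E) /\
  (forall x y, E v x -> E v y -> x != y -> different_directions (g x) (g y)).

Lemma exists_directions v u (d : option K) :
  (neighbours E v #<= [set: option (set_type (residue_field val))])%card ->
  E v u -> d = None \/ d = Some 0 ->
  exists2 g, direction_assignment v g & g u = d.
Proof.
move=> /pcard_injP[h hinj] vu d_def.
have [rep [rep0 repP]] := residue_representatives.
have class0 : residue_class val 0 \in residue_field val.
  by apply/mem_set; exists 0 => //; rewrite /= (val0 hval) leey.
pose d' : option (set_type (residue_field val)) :=
  if d is Some _ then Some (SigSub class0) else None.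
(* On neighbours of [v] this is [h] followed by the transposition of [h u] and [d']. *)
pose h' x := if x == u then d' else if h x == d' then h u else h x.
have h'inj x y : E v x -> E v y -> x != y -> h' x != h' y.
  move=> vx vy xy; rewrite /h'.
  have hne a b : E v a -> E v b -> a != b -> h a != h b.
    by move=> va vb; apply: contra_neq; apply: hinj; apply/mem_set.
  have [xu|xu] := eqVneq x u; have [yu|yu] := eqVneq y u.
  - by rewrite xu yu eqxx in xy.
  - by have [<-|hy] := eqVneq (h y) d'; [rewrite hne|rewrite eq_sym].
  - by have [<-|hx//] := eqVneq (h x) d'; rewrite hne// eq_sym.
  - have [hx|_] := eqVneq (h x) d'; have [hy|_] := eqVneq (h y) d'.
    + by have := hne _ _ vx vy xy; rewrite hx hy eqxx.
    + by rewrite hne// eq_sym.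
    + by rewrite hne.
    + by rewrite hne.
exists (fun x => omap (fun C => rep (\val C)) (h' x)); last first.
  by rewrite /h' eqxx /d'; case: d_def => ->//=; rewrite rep0.
split=> [x r vx|x y vx vy xy].
  case: (h' x) => //= C [<-].
  by have [] := repP (\val C) (set_mem (valP C)).
have := h'inj _ _ vx vy xy; case: (h' x) (h' y) => [C|] [C'|]//= CC'.
have [_] := repP (\val C) (set_mem (valP C)); apply.
  exact: (set_mem (valP C')).
by move=> /val_inj e; rewrite e eqxx in CC'.
Qed.

End Directions.
Arguments different_directions {R K} val d e.
Arguments direction_assignment {R K} val {V} E v g.

(** * Discs at the vertices, built outwards from a root *)

Section LocalStructure.
Context {R : realType} {K : fieldType} {val : K -> \bar R}
  {V : choiceType} {E : rel V} {len : V -> V -> R}.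
Hypotheses (hval : is_valuation val) (htree : is_metric_tree E len).
Hypothesis hdeg : forall v,
  (neighbours E v #<= [set: option (set_type (residue_field val))])%card.
Hypothesis hlen : forall u w, E u w -> ~ leaf_edge E u w ->
  value_group val (len u w).
Let Esym := mt_sym htree.

Lemma has_degree1_eq v x y : has_degree E v 1 -> E v x -> E v y -> x = y.
Proof.
rewrite /has_degree => /eq_cardSP[z _].
rewrite II0 card_eq0 => /eqP/seteqP[sub _] vx vy.
have nz t : E v t -> t = z.
  by move=> vt; apply: contrapT => tz; apply: (sub t); split.
by rewrite (nz x)// (nz y).
Qed.

Definition of_value (v : R) : K := xget 0 [set c | val c = v%:E].

Lemma of_valueP v : value_group val v -> val (of_value v) = v%:E.
Proof.
by move=> [x _ xv]; rewrite /of_value; case: xgetP => [c _ //|/(_ x)].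
Qed.

Definition directions v u (d : option K) : V -> option K :=
  xget (fun=> None) [set g | direction_assignment val E v g /\ g u = d].

Lemma directionsP v u d : E v u -> d = None \/ d = Some 0 ->
  direction_assignment val E v (directions v u d) /\ directions v u d u = d.
Proof.
move=> vu hd; have [g ag gu] := exists_directions hval (hdeg v) vu hd.
by rewrite /directions; case: xgetP => [? _ //|/(_ g)]; case.
Qed.

(* A vertex together with the centre and the radius of its disc, and the
   directions assigned to its neighbours. *)
Let state : Type := V * K * R * (V -> option K).

(** Seen from [w], the previous vertex lies upwards after a descent. After an ascent it lies in the
    class of [0], because the centre was kept. *)
Let step (st : state) (w : V) : state :=
  let: (u, a, r, g) := st in
  if g w is Some t then
    (w, a + of_value r * t, r + len u w, directions w u None)
  else (w, a, r - len u w, directions w u (Some 0)).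

Variable root : V.

Let root_nbr := xget root [set u | E root u].

(* The edge at a root of degree 1 may have a length outside the value group;
   giving the root that length as radius and sending its edge upwards gives
   radius 0 to the other end. *)
Let init : state :=
  (root, 0, if `[< has_degree E root 1 >] then len root root_nbr else 0,
   directions root root_nbr None).

Let st x := foldl step init (tree_path E root x).
Let a x := (st x).1.1.2.
Let rho x := (st x).1.2.
Let g x := (st x).2.

Let st_vertex x : (st x).1.1.1 = x.
Proof.
have last_vertex p : (foldl step init p).1.1.1 = last root p.
  elim/last_ind: p => [//|p y _]; rewrite foldl_rcons last_rcons.
  by case: (foldl _ _ _) => [[[u b] r] h] /=; case: (h y).
by rewrite /st last_vertex; have [] := tree_pathP htree root x.
Qed.

Let st_step x y : tree_path E root y = rcons (tree_path E root x) y ->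
  st y = if g x y is Some t
    then (y, a x + of_value (rho x) * t, rho x + len x y, directions y x None)
    else (y, a x, rho x - len x y, directions y x (Some 0)).
Proof.
move=> e; rewrite {1}/st e foldl_rcons -/(st x) /a /rho /g.
have := st_vertex x; case: (st x) => [[[u b] r] h] /= ->.
by case: (h y).
Qed.

Let child x y := tree_path E root y = rcons (tree_path E root x) y.

Let root_or_child x : x = root \/ exists2 y, E y x & child y x.
Proof.
have [] := tree_pathP htree root x; rewrite /child.
case/lastP: (tree_path E root x) => [|p z]; first by left.
rewrite last_rcons => pth U <-; right; exists (last root p).
  by move: pth; rewrite rcons_path => /andP[].
rewrite (tree_path_eq htree)//.
- by move: pth; rewrite rcons_path => /andP[].
- by move: U; rewrite -rcons_cons rcons_uniq => /andP[].
Qed.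

Let g_assignment x u : E x u -> direction_assignment val E x (g x).
Proof.
move=> xu; case: (root_or_child x) => [e|[y yx yE]]; last first.
  rewrite /g (st_step yE).
  have xy : E x y by rewrite Esym.
  case: (g y x) => [t|].
  - by have [|] := @directionsP x y None xy; first by left.
  - by have [|] := @directionsP x y (Some 0) xy; first by right.
rewrite {}e in xu *.
have -> : g root = directions root root_nbr None.
  by rewrite /g /st (tree_path_eq htree (p := [::])).
have ru : E root root_nbr by rewrite /root_nbr; case: xgetP => // /(_ u).
by have [|] := @directionsP root root_nbr None ru; first by left.
Qed.

Let rho_step x y : child x y ->
  rho y = if g x y is Some _ then rho x + len x y else rho x - len x y.
Proof. by move=> /st_step; rewrite /rho => ->; case: (g x y). Qed.

Let root_deg1 x : has_degree E root 1 -> E root x ->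
  g root x = None /\ rho root = len root x.
Proof.
move=> deg1 rx; have ru : E root root_nbr.
  by rewrite /root_nbr; case: xgetP => // /(_ x).
have e : root_nbr = x := has_degree1_eq deg1 ru rx.
have stE : st root = init by rewrite /st (tree_path_eq htree (p := [::])).
rewrite /g /rho stE /init /= asboolT//; split; last by rewrite e.
by rewrite -e; have [|] := @directionsP root root_nbr None ru; first by left.
Qed.

(** A vertex of degree 1 with a child is the root, since a parent would be a second neighbour. *)
Let deg1_parent x y : E x y -> child x y -> has_degree E x 1 ->
  g x y = None /\ rho x = len x y.
Proof.
move=> xy yE deg1; case: (root_or_child x) => [e|[z zx zE]].
  by rewrite e in xy deg1 *; exact: root_deg1.
have e : z = y by apply: has_degree1_eq deg1 _ xy; rewrite Esym.
have := congr1 size yE; rewrite e in zE; rewrite zE !size_rcons => /eqP.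
by rewrite -{1}[size _]addn0 -addn2 eqn_add2l.
Qed.

(** By induction on the depth. A parent of degree 1 is the root, and its radius cancels against the
    edge length. Any other parent is joined by an edge that is not a leaf edge, whose length is in
    the value group. *)
Let rho_value_group x : ~ has_degree E x 1 -> value_group val (rho x).
Proof.
have [n] := ubnP (size (tree_path E root x)).
elim: n x => // n IH x; rewrite ltnS => sz ndeg.
case: (root_or_child x) => [e|[y yx yE]].
  rewrite {}e in ndeg *.
  have stE : st root = init by rewrite /st (tree_path_eq htree (p := [::])).
  by rewrite /rho stE /= asboolF//; exact: (value_group0 hval).
have szy : (size (tree_path E root y) < n)%N by rewrite yE size_rcons in sz.
rewrite (rho_step yE).
have [degy|ndegy] := pselect (has_degree E y 1).
  have [-> ->] := deg1_parent yx yE degy.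
  by rewrite subrr; exact: (value_group0 hval).
have vl : value_group val (len y x).
  by apply: hlen => //; case=> _ [].
case: (g y x) => [_|].
- by apply: (value_groupD hval) => //; exact: IH.
- by apply: (value_groupB hval) => //; exact: IH.
Qed.

(* The discs (a x, rho x) at the vertices, seen from each vertex y in the
   direction of its neighbour x; this no longer depends on the root. *)
Lemma exists_local_structure :
  exists (a : V -> K) (rho : V -> R) (c : V -> K) (g : V -> V -> option K),
  [/\ forall y x, E y x -> g y x = None ->
        rho x = rho y - len y x /\ ((rho x)%:E <= val (a x - a y)%R)%E,
      forall y x t, E y x -> g y x = Some t ->
        rho x = rho y + len y x /\ a x = a y + c y * t,
      forall y x z, E y x -> E y z -> x != z -> val (c y) = (rho y)%:E &
      forall y x, E y x -> direction_assignment val E y (g y)].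
Proof.
have ndeg1 y x z : E y x -> E y z -> x != z -> ~ has_degree E y 1.
  by move=> yx yz xz deg1; move: xz; rewrite (has_degree1_eq deg1 yx yz) eqxx.
exists a, rho, (of_value \o rho), g; split.
- move=> y x yx gyx; have [yE|xE] := tree_path_edge htree root yx.
    have := st_step yE; rewrite gyx => e; rewrite (rho_step yE) gyx; split=> //.
    by rewrite /a e /= subrr (val0 hval) leey.
  have xy : E x y by rewrite Esym.
  (* Here [y] is a child of [x], and it was reached by a descent: an ascent would have assigned
     [Some 0] to the direction of [x]. *)
  have := st_step xE; case gxy : (g x y) => [t|] e; last first.
    have [|_ e2] := @directionsP y x (Some 0) yx; first by right.
    by move: gyx; rewrite {1}/g e /= e2.
  have [|dy _] := @directionsP y x None yx; first by left.
  (* A parent of degree 1 sends its only edge upwards, so after a descent the radius of the parent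
     is in the value group. *)
  have deg : ~ has_degree E x 1.
    by move=> deg1; have [] := deg1_parent xy xE deg1; rewrite gxy.
  rewrite (rho_step xE) gxy (mt_len_sym htree yx) addrK; split=> //.
  rewrite (valBC hval) [in a y]/a e /= addrC addKr (Defs.valM hval).
  rewrite (of_valueP (rho_value_group deg)) -[leLHS]adde0 leeD2l//.
  by case: (g_assignment xy) => + _; apply; [exact: xy|].
- move=> y x t yx gyx; have [yE|xE] := tree_path_edge htree root yx.
    have := st_step yE; rewrite gyx => e; rewrite (rho_step yE) gyx; split=> //.
    by rewrite {1}/a e.
  have xy : E x y by rewrite Esym.
  (* Conversely, [Some t] towards the parent means an ascent, with [t = 0] and equal centres. *)
  have := st_step xE; case gxy : (g x y) => [s|] e.
    have [|_ e2] := @directionsP y x None yx; first by left.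
    by move: gyx; rewrite {1}/g e /= e2.
  have [|_ e2] := @directionsP y x (Some 0) yx; first by right.
  move: gyx; rewrite {1}/g e /= e2 => -[<-].
  rewrite (rho_step xE) gxy (mt_len_sym htree yx) subrK mulr0 addr0; split=> //.
  by rewrite [in RHS]/a e.
- move=> y x z yx yz xz; apply: of_valueP; apply: rho_value_group.
  exact: ndeg1 xz.
- exact: g_assignment.
Qed.

End LocalStructure.

(** * Extension to the points of the edges *)

Section EmbeddingOfLocalStructure.
Context {R : realType} {K : fieldType} {val : K -> \bar R}
  {V : choiceType} {E : rel V} {len : V -> V -> R}.
Hypotheses (hval : is_valuation val) (htree : is_metric_tree E len).
Context {a : V -> K} {rho : V -> R} {c : V -> K} {g : V -> V -> option K}.
Hypothesis up : forall y x, E y x -> g y x = None ->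
  rho x = rho y - len y x /\ ((rho x)%:E <= val (a x - a y)%R)%E.
Hypothesis down : forall y x t, E y x -> g y x = Some t ->
  rho x = rho y + len y x /\ a x = a y + c y * t.
Hypothesis val_c : forall y x z, E y x -> E y z -> x != z ->
  val (c y) = (rho y)%:E.
Hypothesis g_assignment : forall y x, E y x ->
  direction_assignment val E y (g y).
Let Esym := mt_sym htree.

(* A point of an edge gets the centre of the smaller end of the edge and, by
   interpolation, its radius. *)
Definition point_disc (p : V -> R) : K * R :=
  (xget 0 [set b | exists x, [/\ b = a x, 0 < p x &
             forall y, 0 < p y -> rho y <= rho x]],
   affine_ext rho p).

Lemma point_disc_vertex x : point_disc (vertex_point x) = (a x, rho x).
Proof.
rewrite /point_disc affine_ext_vertex; congr pair.
have pos y : 0 < vertex_point x y :> R -> y = x.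
  by rewrite vertex_pointE; case: eqVneq => // _; rewrite ltxx.
case: xgetP => [b _ [y [-> /pos -> //]]|/(_ (a x))[]].
exists x; split=> //; first by rewrite vertex_pointE eqxx ltr01.
by move=> y /pos ->.
Qed.

(** From [w] the direction of [u] must be upwards, as a descent would increase the radius. *)
Lemma edge_rho u w : E u w -> rho u < rho w ->
  rho w - rho u = len u w /\ ((rho u)%:E <= val (a u - a w)%R)%E.
Proof.
move=> uw lt; have wu : E w u by rewrite Esym.
have l0 := mt_len_gt0 htree wu; rewrite (mt_len_sym htree uw).
case gwu : (g w u) => [t|].
  by have [e _] := down wu gwu; exfalso; lra.
by have [e v] := up wu gwu; split=> //; lra.
Qed.

Lemma edge_rho_neq u w : E u w -> rho u < rho w \/ rho w < rho u.
Proof.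
move=> uw; have l0 := mt_len_gt0 htree uw; case guw : (g u w) => [t|].
  by have [e _] := down uw guw; left; lra.
by have [e v] := up uw guw; right; lra.
Qed.

Lemma point_disc_segment u w s : E u w -> rho u < rho w -> 0 <= s <= 1 ->
  let X := point_disc (segment_point u w s) in
  X.2 = (1 - s) * rho u + s * rho w /\ (X.2%:E <= val (X.1 - a w)%R)%E.
Proof.
move=> uw lt s01 /=; have unw := edge_neq htree uw.
have [_ auw] := edge_rho uw lt.
rewrite affine_ext_segment//; split=> //.
have pw : segment_point u w s w = s by rewrite segment_point_end.
have pu : segment_point u w s u = 1 - s.
  by rewrite segment_pointC segment_point_end// eq_sym.
have px x : 0 < segment_point u w s x -> x = u \/ x = w.
  rewrite /segment_point !vertex_pointE.
  have [->|_] := eqVneq x u; first by left.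
  have [->|_] := eqVneq x w; first by right.
  by rewrite !mulr0 addr0 ltxx.
case: xgetP => [b _ [x [-> x0 xmax]]|none].
  have [xu|->] := px x x0; last by rewrite subrr (val0 hval) leey.
  (* The larger radius is at [w], so [u] can supply the centre only if [w] has coordinate zero. *)
  rewrite xu in x0 xmax *; have s0 : s = 0.
    apply/eqP; move: s01; rewrite le_eqVlt eq_sym => /andP[/orP[//|s0] _].
    by have := xmax w; rewrite pw => /(_ s0); rewrite leNgt lt.
  by rewrite s0 subr0 mul1r mul0r addr0.
(* The default centre does not occur: [w] qualifies when [s] is positive, and [u] when [s = 0]. *)
exfalso; case: (ltrP 0 s) => [s0|s0].
  apply: (none (a w)); exists w; rewrite pw; split=> // y /px[->|->//].
  exact: ltW.
have {s0 s01} s0 : s = 0 by lra.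
apply: (none (a u)); exists u; rewrite pu; split=> //.
  by rewrite s0 subr0.
move=> y y0; have [->//|yw] := px y y0.
by move: y0; rewrite yw pw s0 ltxx.
Qed.

(** Both discs contain the centre of the smaller end, so they are nested, and their distance is the
    difference of the radii, which are interpolated linearly. *)
Lemma point_disc_isometric_segment u w s t : E u w ->
  0 <= s <= 1 -> 0 <= t <= 1 ->
  disc_dist (val := val) (point_disc (segment_point u w s))
    (point_disc (segment_point u w t)) = len u w * `|s - t|.
Proof.
move=> uw s01 t01; wlog lt : u w s t uw s01 t01 / rho u < rho w.
  move=> wl; have [|lt] := edge_rho_neq uw; first exact: wl.
  rewrite (segment_pointC u w s) (segment_pointC u w t) wl 1?Esym//; try lra.
  rewrite (mt_len_sym htree uw); congr (_ * _).
  by rewrite [RHS]distrC; congr `|_|; lra.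
wlog st : s t s01 t01 / s <= t.
  move=> wl; case: (leP s t) => [|/ltW]; first exact: wl.
  by rewrite (disc_distC hval) distrC; exact: wl.
have [sr sv] := point_disc_segment uw lt s01.
have [tr tv] := point_disc_segment uw lt t01.
have [<- _] := edge_rho uw lt.
have st0 : 0 <= (t - s) * (rho w - rho u) by apply: mulr_ge0; lra.
rewrite disc_dist_nested//.
- by rewrite distrC ger0_norm ?subr_ge0// sr tr; ring.
- by rewrite sr tr; lra.
apply: (le_valB hval sv); rewrite (valBC hval); apply: le_trans tv.
by rewrite lee_fin sr tr; lra.
Qed.

(** At most one direction is upwards, say that of [x]; then the disc of [x] contains that of [z]. If
    both go down, the centres differ by [c y] times a unit, and the join is the disc of [y]. *)
Lemma point_disc_turn y x z : E y x -> E y z -> x != z ->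
  disc_dist (val := val) (point_disc (vertex_point x))
    (point_disc (vertex_point z)) = len y x + len y z.
Proof.
move=> yx yz xz; rewrite !point_disc_vertex.
wlog nNone : x z yx yz xz / g y z = None -> g y x = None.
  move=> wl; case gyz: (g y z) => [r|]; first by apply: wl => //; rewrite gyz.
  by rewrite (disc_distC hval) addrC wl// eq_sym.
have lx := mt_len_gt0 htree yx; have lz := mt_len_gt0 htree yz.
have vc := val_c yx yz xz; have [gpos gdiff] := g_assignment yx.
have := gdiff _ _ yx yz xz.
case gyz : (g y z) => [r|]; last by rewrite nNone.
have [ez cz] := down yz gyz; have r0 := gpos _ _ yz gyz.
case gyx : (g y x) => [t|] /=.
  have [ex cx] := down yx gyx => tr.
  have v : val (a x - a z) = (rho y)%:E.
    have -> : a x - a z = c y * (t - r) by rewrite cx cz; ring.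
    by rewrite (Defs.valM hval) vc tr adde0.
  rewrite /disc_dist (@join_radius_eq _ _ _ hval (rho y)) /= ?v//.
  - lra.
  - lra.
  - lra.
  - by right; right.
move=> _; have [ex vx] := up yx gyx.
rewrite disc_dist_nested//=; [lra|lra|].
apply: (le_valB hval vx).
rewrite cz (valBC hval) addrC addKr (Defs.valM hval) vc.
have := leeD2l (rho y)%:E r0; rewrite adde0; apply: le_trans.
by rewrite lee_fin; lra.
Qed.

End EmbeddingOfLocalStructure.

Arguments point_disc {R K V} a rho p.

(** * Structure of an embedded tree *)

Section StructureOfEmbedding.
Context {R : realType} {K : fieldType} {val : K -> \bar R}
  {V : choiceType} {E : rel V} {len : V -> V -> R}.
Hypotheses (hval : is_valuation val) (htree : is_metric_tree E len).
Context {h : V -> K * R}.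
Local Notation D x y := (disc_dist (val := val) (h x) (h y)).
Local Notation m x y := (join_radius (val := val) (h x) (h y)).
Local Notation rho x := (h x).2.
Hypothesis D_edge : forall y x, E y x -> D y x = len y x.
Hypothesis D_turn : forall y x z, E y x -> E y z -> x != z ->
  D x z = len y x + len y z.
Let Esym := mt_sym htree.

Lemma join_radius_turn y x z : E y x -> E y z -> x != z ->
  m y x + m y z = rho y + m x z.
Proof.
by move=> yx yz xz; have := D_turn yx yz xz;
  rewrite -(D_edge yx) -(D_edge yz) /disc_dist; lra.
Qed.

(** As [m y x] never exceeds [rho y], this says that the join is the disc of [y], which therefore
    contains that of [x]. *)
Definition below y x := rho y <= m y x.

(** If [m y x] and [m y z] were both less than [rho y], additivity at [y] would make [m x z] smaller
    than either, against the ultrametric inequality. *)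
Lemma not_below_unique y x z : E y x -> E y z ->
  ~ below y x -> ~ below y z -> x = z.
Proof.
rewrite /below => yx yz /negP + /negP; rewrite -!ltNge => bx bz.
have [//|xz] := eqVneq x z; have e := join_radius_turn yx yz xz.
have := join_radius_ultra hval (h x) (h y) (h z).
rewrite ge_min (join_radiusC hval (h x) (h y)) => le.
by exfalso; case/orP: le; lra.
Qed.

(** Additivity at [y] gives [m x z = rho y]. Edges have positive length, so both radii exceed
    [rho y], and the minimum [m x z] is attained by the valuation. *)
Lemma below_val y x z : E y x -> E y z -> x != z -> below y x -> below y z ->
  val ((h x).1 - (h z).1) = (rho y)%:E.
Proof.
move=> yx yz xz bx bz; have [my mx] := join_radius_le hval (h y) (h x).
have [my' mz] := join_radius_le hval (h y) (h z).
have := join_radius_turn yx yz xz; rewrite /below in bx bz => e.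
have dx := mt_len_gt0 htree yx; have dz := mt_len_gt0 htree yz.
rewrite -(D_edge yx) /disc_dist in dx; rewrite -(D_edge yz) /disc_dist in dz.
have mxz : m x z = rho y by lra.
apply/le_anti/andP; split; last first.
  by rewrite -mxz; exact: join_radius_val.
rewrite leNgt; apply/negP => lt; have := join_radiusE hval (h x) (h z).
move/eqP; apply/negP; rewrite lt_eqF// mxz !lt_min !lte_fin lt andbT.
by apply/andP; split; lra.
Qed.

Lemma card_neighbours_le y :
  (neighbours E y #<= [set: option (set_type (residue_field val))])%card.
Proof.
(* The centre of [x] relative to that of [y], rescaled by the radius of [y]. The default [0] covers
   radii outside the value group, where at most one neighbour is below [y]. *)
pose k x := if `[< value_group val (rho y) >]
  then ((h x).1 - (h y).1) / of_value (val := val) (rho y) else 0.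
have k0 x : below y x -> residue_class val (k x) \in residue_field val.
  move=> b; apply/mem_set; exists (k x) => //=; rewrite /k.
  case: asboolP => [/of_valueP vc|_]; last by rewrite (val0 hval) leey.
  rewrite (Defs.valM hval) (valV hval vc).
  have : ((rho y)%:E <= val ((h x).1 - (h y).1)%R)%E.
    rewrite (valBC hval); apply: le_trans (join_radius_val hval _ _).
    by rewrite lee_fin.
  by move=> /(leeD2r (- rho y)%:E); rewrite -EFinD subrr.
(* [None] is left for the at most one neighbour that is not below [y]. *)
apply/pcard_injP; exists (fun x => if pselect (below y x) is left b
  then Some (SigSub (k0 x b)) else None).
move=> x z /set_mem yx /set_mem yz.
case: pselect => [bx|nbx]; case: pselect => [bz|nbz] //.
  have [//|xz] := eqVneq x z.
  move=> [/eq_residue_class-/(_ hval)]; have v := below_val yx yz xz bx bz.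
  have gy : value_group val (rho y).
    by exists ((h x).1 - (h z).1) => //; exact: (val_fin_neq0 hval v).
  rewrite /k asboolT// -mulrBl (Defs.valM hval) (valV hval (of_valueP gy)).
  rewrite (_ : _ - _ = (h x).1 - (h z).1); last by ring.
  by rewrite v -EFinD subrr ltxx.
by move=> _; exact: not_below_unique nbx nbz.
Qed.

Lemma three_neighbours y x :
  E y x -> ~ has_degree E y 1 -> ~ has_degree E y 2 ->
  exists z t, [/\ E y z, E y t, x != z, x != t & z != t].
Proof.
move=> yx n1 n2.
have [z yz xz] : exists2 z, E y z & x != z.
  apply: contrapT => nz; apply: n1; rewrite /has_degree.
  rewrite (_ : neighbours E y = [set x]) ?card_set1//.
  apply/seteqP; split=> [z yz|z ->//]; apply/esym/eqP.
  by apply/negPn/negP => xz; apply: nz; exists z.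
apply: contrapT => nt; apply: n2; apply/eq_cardSP; exists x => //.
rewrite (_ : neighbours E y `\ x = [set z]) ?card_set1//.
apply/seteqP; split=> [t [yt tx]|t ->]; last first.
  by split=> //; apply/eqP; rewrite eq_sym.
apply/esym/eqP/negPn/negP => zt; apply: nt; exists z, t; split=> //.
by rewrite eq_sym; apply/eqP.
Qed.

(** Of three neighbours at least two are below [y], and their centres differ by an element of
    valuation [rho y]. *)
Lemma radius_value_group y x : E y x -> ~ has_degree E y 1 ->
  ~ has_degree E y 2 -> value_group val (rho y).
Proof.
move=> yx n1 n2; have [z [t [yz yt xz xt zt]]] := three_neighbours yx n1 n2.
have two u v : E y u -> E y v -> u != v -> below y u -> below y v ->
    value_group val (rho y).
  move=> yu yv uv bu bv; have v' := below_val yu yv uv bu bv.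
  by exists ((h u).1 - (h v).1) => //; exact: (val_fin_neq0 hval v').
have nb u v : E y u -> E y v -> u != v -> ~ below y u -> below y v.
  move=> yu yv /eqP uv bu; apply: contrapT => bv; apply: uv.
  exact: not_below_unique bu bv.
have [bx|nbx] := pselect (below y x).
  have [bz|nbz] := pselect (below y z); first exact: (two x z).
  by apply: (two x t) => //; exact: (nb z t).
by apply: (two z t) => //; [exact: (nb x z)|exact: (nb x t)].
Qed.

(** Both ends have degree at least 3, so their radii are values. Then so is [m u w], a minimum of
    these radii and a valuation, and the distance is an integral combination of the three. *)
Lemma edge_value_group u w : E u w -> ~ leaf_edge E u w ->
  (forall v, ~ has_degree E v 2) -> value_group val (D u w).
Proof.
move=> uw nleaf deg2.
have gu : value_group val (rho u).
  apply: (radius_value_group uw _ (deg2 u)) => d.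
  by apply: nleaf; split; [|left].
have gw : value_group val (rho w).
  have wu : E w u by rewrite Esym.
  apply: (radius_value_group wu _ (deg2 w)) => d.
  by apply: nleaf; split; [|right].
have gm : value_group val (m u w).
  have := join_radiusE hval (h u) (h w); rewrite -EFin_min.
  have gmin : value_group val (Order.min (rho u) (rho w)) by case: leP.
  case: (leP (Order.min (rho u) (rho w))%:E) => [_ [->]//|_ e].
  by exists ((h u).1 - (h w).1) => //; apply: (val_fin_neq0 hval (esym e)).
rewrite /disc_dist mulr_natl mulr2n.
apply: (value_groupB hval); exact: value_groupD.
Qed.

End StructureOfEmbedding.

(** * The embedding criterion *)

Theorem proposition34 (R : realType) (K : fieldType) (val : K -> \bar R)
    (hval : is_valuation val) (hnontriv : nontrivial_valuation val)
    (hcomplete : vcomplete val)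
    (Kbar : closedFieldType) (i : {rmorphism K -> Kbar})
    (Khat : fieldType) (j : {rmorphism Kbar -> Khat})
    (valhat : Khat -> \bar R)
    (hKhat : completed_alg_closure val i j valhat)
    (V : choiceType) (E : rel V) (len : V -> V -> R)
    (htree : is_metric_tree E len)
    (hdeg2 : forall v : V, ~ has_degree E v 2) :
  (exists f : (V -> R) -> set Khat,
     isometric_embedding (realization E) (tree_dist E len)
       (discs (j \o i) valhat) (dH val (j \o i) valhat) f)
  <->
  (forall v : V,
     (neighbours E v #<= [set: option (set_type (residue_field val))])%card) /\
  (forall v v' : V, E v v' -> ~ leaf_edge E v v' ->
     value_group val (tree_dist E len (vertex_point v) (vertex_point v'))).
Proof.
have hvalhat := cac_valuation hKhat.
have dHE (X Y : K * R) : dH val (j \o i) valhat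
    (disc (j \o i) valhat X.1 X.2) (disc (j \o i) valhat Y.1 Y.2) =
    disc_dist (val := val) X Y.
  apply: (dH_disc (iota := GRing.RMorphism.clone _ _ (j \o i) _)) => //.
    by move=> b; exact: (cac_extends hKhat).
  exact: (valhat_dense hval hnontriv hKhat).
split=> [[f [fdisc fiso]]|[hdeg hlen]].
  have [h hE] : {h : V -> K * R & forall v,
      f (vertex_point v) = disc (j \o i) valhat (h v).1 (h v).2}.
    apply: (@choice _ _ (fun v X =>
      f (vertex_point v) = disc (j \o i) valhat X.1 X.2)) => v.
    have [|b [r fE]] := fdisc (vertex_point v).
      by left; exists v.
    by exists (b, r).
  have hdist u w : disc_dist (val := val) (h u) (h w) =
      tree_dist E len (vertex_point u) (vertex_point w).
    by rewrite -dHE -!hE fiso//; left; [exists u|exists w].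
  have edge y x : E y x -> disc_dist (val := val) (h y) (h x) = len y x.
    by move=> yx; rewrite hdist tree_dist_edge.
  have turn y x z : E y x -> E y z -> x != z ->
      disc_dist (val := val) (h x) (h z) = len y x + len y z.
    by move=> yx yz xz; rewrite hdist (tree_dist_turn htree yx).
  split=> [v|u w uw nleaf].
    exact: (card_neighbours_le hval htree edge turn).
  by rewrite -hdist; exact: (edge_value_group hval htree edge turn).
have hlen' u w : E u w -> ~ leaf_edge E u w -> value_group val (len u w).
  by move=> uw /(hlen u w uw); rewrite tree_dist_edge.
(* The construction starts from a root; without vertices the realization is empty. *)
have [[root _]|noV] := pselect (exists v : V, True); last first.
  have noE p : ~ realization E p.
    by case=> [[v _ _]|[u _]]; apply: noV; [exists v|exists u].
  by exists (fun=> set0); split=> [p /noE//|p q /noE//].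
have [a [rho [c [g [up down vc asg]]]]] :=
  exists_local_structure hval htree hdeg hlen' root.
exists (fun p => let X := point_disc a rho p in disc (j \o i) valhat X.1 X.2).
split.
  by move=> p _; exists (point_disc a rho p).1, (point_disc a rho p).2.
move=> p q Ep Eq; rewrite dHE.
apply: (local_to_global htree hval (F := point_disc a rho)) => //.
- by move=> u w s t; exact: (point_disc_isometric_segment hval htree up down).
- exact: (point_disc_turn hval htree up down vc asg).
Qed.
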